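(* Let $G$ be an arena with (finite) vertex set $V$ and let $k\ge 1$ be an integer. Every finite word $w\in V^*$ with $|w|\ge k^{|V|}$ satisfies $\mathrm{MaxSc}_{2^V}(w)\ge k$.
   Context: An arena is a finite directed graph in which every vertex has at least one outgoing edge, whose vertex set $V$ is partitioned into positions of two players (only the finite set $V$ matters here). For a finite word $x$ over $V$, $\mathrm{Occ}(x)$ is the set of vertices occurring in $x$. For $F\subseteq V$ and $w\in V^+$, the score $\mathrm{Sc}_F(w)$ is the maximal $m\in\mathbb{N}$ such that there are non-empty words $x_1,\dots,x_m\in V^+$ with $\mathrm{Occ}(x_j)=F$ for all $j$ and $x_1\cdots x_m$ a suffix of $w$. For $\mathcal{F}\subseteq 2^V$ and a word $w$, $\mathrm{MaxSc}_{\mathcal{F}}(w)=\max_{F\in\mathcal{F}}\max_{u\sqsubseteq w}\mathrm{Sc}_F(u)$, where $u$ ranges over finite non-empty prefixes of $w$. *)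

(* Defs.v *)
From mathcomp Require Import all_boot boolp.
Set Implicit Arguments.
Unset Strict Implicit.
Unset Printing Implicit Defensive.

Record arena := Arena {
  vertex :> finType;
  player0 : {set vertex};
  player1 : {set vertex};
  edge : rel vertex;
  players_cover : player0 :|: player1 = [set: vertex];
  players_disjoint : player0 :&: player1 = set0;
  edge_total : forall v, exists v', edge v v'
}.

Section Score.
Variable V : finType.
Implicit Types (F : {set V}) (FF : {set {set V}}) (w x : seq V) (m : nat).

Definition Occ x : {set V} := [set v in x].

Definition has_blocks F w m : Prop :=
  exists xs : seq (seq V),
    [/\ size xs = m,
        forall x, x \in xs -> x != [::] /\ Occ x = F
      & suffix (flatten xs) w].

Lemma has_blocks0 F w : exists m, `[< has_blocks F w m >].
Proof. by exists 0; apply/asboolP; exists [::]; split=> //; apply: suffix0s. Qed.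

Lemma has_blocks_le F w m : `[< has_blocks F w m >] -> m <= size w.
Proof.
move=> /asboolP[xs [<- xsF /size_suffix]]; apply: leq_trans.
elim: xs xsF => //= x xs IHxs xsF; rewrite size_cat -add1n leq_add //.
  by have [] := xsF x (mem_head x xs); case: x {xsF}.
by apply: IHxs => y y_xs; apply: xsF; rewrite in_cons y_xs orbT.
Qed.

Definition Sc F w : nat := ex_maxn (has_blocks0 F w) (@has_blocks_le F w).

(* The words take i w with 1 <= i <= size w are the non-empty prefixes of w;
   the maximum is 0 if there are none, or if FF is empty. *)
Definition MaxSc FF w : nat :=
  \max_(F in FF) \max_(1 <= i < (size w).+1) Sc F (take i w).

End Score.

(* Main.v *)
(* Induction on the size of an alphabet containing the letters of w: cut the
   first k ^ n.+1 letters of w into k blocks of length k ^ n.  Either all blocks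
   have the whole alphabet as occurrence set, and are then themselves the words
   witnessing a score of k, or some block misses a letter, and induction applies
   to that block. *)
Require Import Defs.
From mathcomp Require Import all_boot boolp.

(** The induction passes to a block inside [w] and to a smaller alphabet: hence an infix instead of
    a suffix, and a set [A] instead of all of [V]. *)
Lemma exists_infix_blocks (V : finType) (k : nat) (A : {set V}) (w : seq V) :
  0 < k -> {subset w <= A} -> k ^ #|A| <= size w ->
  exists F xs, [/\ size xs = k, forall x, x \in xs -> x != [::] /\ Occ x = F
                 & infix (flatten xs) w].
Proof.
move=> k_gt0; move: {2}#|A| (erefl #|A|) => n.
elim: n A w => [|n IHn] A w cardA wA; rewrite cardA => le_w.
  (* As [k ^ 0 = 1], the word has a first letter, which would lie in the empty set [A]. *)
  case: w wA le_w => // a w /(_ a (mem_head a w)).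
  by rewrite (cards0_eq cardA) inE.
(* The truncation makes the sizes agree: [reshape] fills every block and [flatten] gives back all of
   [w']. *)
pose w' := take (k ^ n.+1) w; pose xs := reshape (nseq k (k ^ n)) w'.
have size_w' : size w' = sumn (nseq k (k ^ n)).
  by rewrite size_takel // sumn_nseq mulnC -expnS.
have flat_xs : flatten xs = w' by rewrite reshapeKr ?size_w'.
have shape_xs : shape xs = nseq k (k ^ n) by rewrite reshapeKl ?size_w'.
have size_xs : size xs = k.
  by rewrite -(size_map size) -/(shape xs) shape_xs size_nseq.
have size_x x : x \in xs -> size x = k ^ n.
  move=> /(map_f size); rewrite -/(shape xs) shape_xs mem_nseq.
  by case/andP=> _ /eqP.
have w'w : infix w' w by rewrite prefixW // prefix_take.
have xw x : x \in xs -> infix x w.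
  move=> x_xs; apply: (infix_trans _ w'w); rewrite -flat_xs.
  case/splitPr: x_xs => s1 s2; rewrite flatten_cat /=.
  exact: infix_infix.
have xA x : x \in xs -> {subset x <= A}.
  by move=> x_xs v vx; apply/wA/(mem_infix (xw x x_xs)).
have [/allP xsA | /allPn[x x_xs OccxNA]] :=
    boolP (all (fun x => Occ x == A) xs).
  exists A, xs; split=> // [x x_xs|]; last by rewrite flat_xs.
  rewrite -size_eq0 size_x // -lt0n expn_gt0 k_gt0.
  by split=> //; apply/eqP/xsA.
have OccxA : Occ x \subset A by apply/subsetP=> v; rewrite inE; apply: xA.
(* [x] omits some [a] in [A], so it is a word over [A :\ a], long enough for [IHn]. *)
have /properP[_ [a aA]] : Occ x \proper A by rewrite properEneq OccxNA.
rewrite inE => a_x.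
have cardAa : #|A :\ a| = n by apply/eqP; rewrite -eqSS -cardA (cardsD1 a A) aA.
have [v vx||F [ys [size_ys ysF ys_x]]] := IHn (A :\ a) x cardAa.
- by rewrite !inE (xA x) // andbT; apply: contraNneq a_x => <-.
- by rewrite cardAa size_x.
by exists F, ys; split=> //; apply: infix_trans ys_x (xw x x_xs).
Qed.

Lemma leq_Sc (V : finType) (F : {set V}) (w : seq V) (m : nat) :
  has_blocks F w m -> m <= Sc F w.
Proof.
by rewrite /Sc; case: ex_maxnP => i _ max_i wFm; apply/max_i/asboolP.
Qed.

Lemma Sc_leq_MaxSc (V : finType) (FF : {set {set V}}) (F : {set V})
    (w : seq V) (i : nat) :
  F \in FF -> 0 < i <= size w -> Sc F (take i w) <= MaxSc FF w.
Proof.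
move=> FFF i_w; apply: leq_trans _ (leq_bigmax_cond _ FFF).
by apply: (leq_bigmax_seq i); rewrite ?mem_index_iota.
Qed.

Theorem lemma6 (G : arena) (k : nat) (w : seq G) :
  1 <= k -> k ^ #|G| <= size w -> k <= MaxSc (powerset [set: G]) w.
Proof.
move=> k_gt0 le_w.
have [||F [xs [size_xs xsF]]] := @exists_infix_blocks G k [set: G] w k_gt0.
- by move=> v _; rewrite inE.
- by rewrite cardsT.
move=> /infixP[s1 [s2 def_w]].
(* [MaxSc] ranges over non-empty prefixes only; [k_gt0] provides a block. *)
have flat_gt0 : 0 < size (flatten xs).
  case: xs size_xs xsF {def_w} => [|x xs] size_xs xsF.
    by rewrite -size_xs in k_gt0.
  have [xN0 _] := xsF x (mem_head x xs).
  by rewrite /= size_cat ltn_addr // lt0n size_eq0.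
(* The prefix of [w] that stops where the infix ends has the blocks as a suffix. *)
have i_w : 0 < size (s1 ++ flatten xs) <= size w.
  by rewrite def_w catA [size (_ ++ s2)]size_cat leq_addr size_cat ltn_addl.
have FT : F \in powerset [set: G] by rewrite inE subsetT.
apply: leq_trans _ (Sc_leq_MaxSc _ _ _ _ _ FT i_w); apply: leq_Sc.
by exists xs; split=> //; rewrite def_w catA take_size_cat // suffix_suffix.
Qed.
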